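(* Let $H\le \mathrm{PL}_0(\mathbf{I})$ be a subgroup isomorphic to Thompson's group $F$. Then there exist an orbital $W=(a,c)$ of $H$ and an element $h\in H$ such that either $h|_W$ moves points near $a$ but not near $c$, or $h|_W$ moves points near $c$ but not near $a$.
   Context: $\mathrm{PL}_0(\mathbf{I})$ is the group of orientation-preserving piecewise-linear homeomorphisms of $[0,1]$ with finitely many points of non-differentiability. For a subgroup $H$, $\operatorname{Supp}(H)=\{x\in[0,1]: xh\ne x \text{ for some } h\in H\}$; it is a disjoint union of open intervals, called the orbitals of $H$. Thompson's group $F=\langle x_0,x_1\mid [x_0x_1^{-1},x_1^{x_0}]=[x_0x_1^{-1},x_1^{x_0^2}]=1\rangle$. ''$h|_W$ moves points near $a$ but not near $c$'' means: for every $\varepsilon>0$, $h$ is not the identity on $(a,a+\varepsilon)$, while for some $\delta>0$, $h$ is the identity on $(c-\delta,c)$; symmetrically for the other case. *)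

(* Defs.v *)
From Stdlib Require Import Reals Lra List.
Import ListNotations.
Open Scope R_scope.

(* Elements of PL_0(I) are represented as functions R -> R that are the
   identity outside [0,1] (a normalization, so that functional equality is
   the equality of homeomorphisms of [0,1]). *)
Definition is_PL0 (f : R -> R) : Prop :=
  (forall x, (x < 0 \/ 1 < x) -> f x = x) /\
  f 0 = 0 /\ f 1 = 1 /\
  (forall x y, 0 <= x -> x < y -> y <= 1 -> f x < f y) /\
  (exists (n : nat) (t : nat -> R),
      t 0%nat = 0 /\ t n = 1 /\
      (forall i, (i < n)%nat -> t i < t (S i)) /\
      (forall i, (i < n)%nat -> exists m b : R,
          forall x, t i <= x <= t (S i) -> f x = m * x + b)).

Definition is_PL0_subgroup (H : (R -> R) -> Prop) : Prop :=
  (forall f, H f -> is_PL0 f) /\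
  H (fun x => x) /\
  (forall f g, H f -> H g -> H (fun x => g (f x))) /\
  (forall f, H f -> exists g, H g /\ forall x, g (f x) = x /\ f (g x) = x).

(* Words over x0, x1 and their inverses: (generator index, inverse flag);
   generator false = x0, true = x1. *)
Definition letter := (bool * bool)%type.
Definition word := list letter.
Definition inv_letter (l : letter) : letter := (fst l, negb (snd l)).

Definition x0 : letter := (false, false).
Definition X0 : letter := (false, true).
Definition x1 : letter := (true, false).
Definition X1 : letter := (true, true).

(* Conventions: [a,b] = a^-1 b^-1 a b, y^z = z^-1 y z.
   r1 = [x0 x1^-1, x1^x0],  r2 = [x0 x1^-1, x1^(x0^2)]. *)
Definition rel1 : word :=
  [x1; X0] ++ [X0; X1; x0] ++ [x0; X1] ++ [X0; x1; x0].
Definition rel2 : word :=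
  [x1; X0] ++ [X0; X0; X1; x0; x0] ++ [x0; X1] ++ [X0; X0; x1; x0; x0].
Definition F_relators : list word := [rel1; rel2].

Inductive Fequiv : word -> word -> Prop :=
| Fe_refl w : Fequiv w w
| Fe_sym w v : Fequiv w v -> Fequiv v w
| Fe_trans u v w : Fequiv u v -> Fequiv v w -> Fequiv u w
| Fe_free u v l : Fequiv (u ++ l :: inv_letter l :: v) (u ++ v)
| Fe_rel u v r : In r F_relators -> Fequiv (u ++ r ++ v) (u ++ v).

(* Evaluation of a word, with the right-action convention of the paper:
   x.(w1 w2) = (x.w1).w2. *)
Definition gen_eval (a ai b bi : R -> R) (l : letter) : R -> R :=
  match l with
  | (false, false) => a | (false, true) => ai
  | (true, false) => b | (true, true) => bi
  end.

Fixpoint word_eval (a ai b bi : R -> R) (w : word) : R -> R :=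
  match w with
  | [] => fun x => x
  | l :: w' => fun x => word_eval a ai b bi w' (gen_eval a ai b bi l x)
  end.

(* H is isomorphic to F = < x0, x1 | rel1, rel2 >: there are images a, b of
   x0, x1 in H (with inverses ai, bi) such that the induced map from words
   is onto H and its fibres are exactly the Fequiv-classes. *)
Definition iso_to_F (H : (R -> R) -> Prop) : Prop :=
  exists a ai b bi : R -> R,
    H a /\ H ai /\ H b /\ H bi /\
    (forall x, ai (a x) = x /\ a (ai x) = x) /\
    (forall x, bi (b x) = x /\ b (bi x) = x) /\
    (forall h, H h -> exists w, forall x, h x = word_eval a ai b bi w x) /\
    (forall w v, (forall x, word_eval a ai b bi w x = word_eval a ai b bi v x)
                 <-> Fequiv w v).

(* Support of H and its orbitals (connected components of the open set Supp(H)). *)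
Definition in_supp (H : (R -> R) -> Prop) (x : R) : Prop :=
  0 <= x <= 1 /\ exists h, H h /\ h x <> x.

Definition is_orbital (H : (R -> R) -> Prop) (a c : R) : Prop :=
  a < c /\ (forall x, a < x < c -> in_supp H x) /\
  ~ in_supp H a /\ ~ in_supp H c.

Definition moves_near_left_only (h : R -> R) (a c : R) : Prop :=
  (forall eps, 0 < eps -> exists x, a < x < a + eps /\ x < c /\ h x <> x) /\
  (exists delta, 0 < delta /\ forall x, c - delta < x < c -> a < x -> h x = x).

Definition moves_near_right_only (h : R -> R) (a c : R) : Prop :=
  (forall eps, 0 < eps -> exists x, c - eps < x < c /\ a < x /\ h x <> x) /\
  (exists delta, 0 < delta /\ forall x, a < x < a + delta -> x < c -> h x = x).

(* Main.v *)
(** If no element of [H] moves points near exactly one end of an orbital, then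
    for every [h] in [H] and every orbital [(p, q)] the slope of [h] at [p] is 1
    iff its slope at [q] is 1.  Take an orbital on which [x0] and [x1] do not
    commute, and put [x_(n+1) = x_n^x0].  Suppose [x0] and [x1] have different
    slopes at [p], hence also at [q].  Then [y = x0 x1^-1] has no fixed points
    near either end.  It commutes with every [x_n], [n >= 2], and these all have
    the same slope at each end, so they agree near both ends: the germs of the
    centralizer of [y] are determined by their slopes.  The set of [z] such that
    [x_m = x_(m+1)] on [[p, z]] for all large [m] is invariant under [x0] and
    [x1], because both conjugate [x_m] to [x_(m+1)]; its supremum is a common
    fixed point, hence is [q].  The same holds from the other end, so
    [x_m = x_(m+1)] on the whole orbital for large [m]; conjugating back,
    [x1 = x1^x0] there, a contradiction.  If the slopes of [x0] and [x1] agree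
    at [p], they are not 1, and the argument applies to [x0^-1] and
    [x0 x1 x0^-2], which satisfy the same relations (this is the automorphism of
    [F] that reverses the unit interval). *)

Require Import Defs.
From Stdlib Require Import Reals Lra Lia List Classical.
Import ListNotations.
Open Scope R_scope.

(** * Inverse pairs, increasing maps and reflection of the line *)

Definition inverses (f g : R -> R) : Prop := forall x, g (f x) = x /\ f (g x) = x.

Lemma inverses_sym f g : inverses f g -> inverses g f.
Proof. intros H x; destruct (H x); auto. Qed.

Lemma inverses_inj f g x y : inverses f g -> f x = f y -> x = y.
Proof. intros H E; rewrite <- (proj1 (H x)), E; apply H. Qed.

Lemma increasing_le f x y : strict_increasing f -> x <= y -> f x <= f y.
Proof. intros H [h | ->]; [left; auto | right; auto]. Qed.

Lemma increasing_inv f g : inverses f g -> strict_increasing f -> strict_increasing g.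
Proof.
intros I H x y h.
destruct (Rlt_or_le (g x) (g y)) as [k | k]; auto.
apply (increasing_le f) in k; auto.
rewrite (proj2 (I x)), (proj2 (I y)) in k; lra.
Qed.

(** Conjugation by [x -> -x]. It exchanges left and right germs and preserves slopes, so arguments
    at a left end transfer to a right end. *)
Definition mirror (f : R -> R) (x : R) : R := - f (- x).

Lemma inverses_mirror f g : inverses f g -> inverses (mirror f) (mirror g).
Proof.
intros H x; unfold mirror.
rewrite !Ropp_involutive, (proj1 (H (- x))), (proj2 (H (- x))); split; ring.
Qed.

Lemma increasing_mirror f : strict_increasing f -> strict_increasing (mirror f).
Proof.
intros H x y h; unfold mirror.
assert (f (- y) < f (- x)) by (apply H; lra); lra.
Qed.

(** * Germs of slopes at fixed points *)

Definition slope_right (f : R -> R) (p m : R) : Prop :=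
  exists d, 0 < d /\ forall x, p <= x <= p + d -> f x = p + m * (x - p).

Definition slope_left (f : R -> R) (q m : R) : Prop := slope_right (mirror f) (- q) m.

Lemma slope_right_comp f g p m n : 0 < m ->
  slope_right f p m -> slope_right g p n -> slope_right (fun x => g (f x)) p (m * n).
Proof.
intros m0 [d [d0 Hd]] [e [e0 He]].
exists (Rmin d (e / m)); split.
{ apply Rmin_pos; auto; apply Rdiv_lt_0_compat; auto. }
intros x hx.
pose proof (Rmin_l d (e / m)); pose proof (Rmin_r d (e / m)).
rewrite Hd by lra.
assert (0 <= m * (x - p)) by (apply Rmult_le_pos; lra).
assert (m * (x - p) <= e).
{ replace e with (m * (e / m)) by (field; lra).
  apply Rmult_le_compat_l; lra. }
rewrite He by lra; ring.
Qed.

Lemma slope_right_inv f g p m : inverses f g -> 0 < m ->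
  slope_right f p m -> slope_right g p (/ m).
Proof.
intros I m0 [d [d0 Hd]].
exists (m * d); split; [apply Rmult_lt_0_compat; auto |].
intros x hx.
apply (inverses_inj f g); auto.
rewrite (proj2 (I x)), Hd; [field; lra |].
assert (0 < / m) by (apply Rinv_0_lt_compat; auto).
assert (0 <= / m * (x - p)) by (apply Rmult_le_pos; lra).
assert (/ m * (x - p) <= / m * (m * d)) by (apply Rmult_le_compat_l; lra).
replace (/ m * (m * d)) with d in * by (field; lra); lra.
Qed.

Lemma slope_right_ext f g p m : (forall x, f x = g x) ->
  slope_right f p m -> slope_right g p m.
Proof. intros E [d [d0 Hd]]; exists d; split; auto; intros x hx; rewrite <- E; auto. Qed.

Lemma slope_left_comp f g p m n : 0 < m ->
  slope_left f p m -> slope_left g p n -> slope_left (fun x => g (f x)) p (m * n).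
Proof.
intros m0 Hf Hg; unfold slope_left.
apply (slope_right_ext (fun x => mirror g (mirror f x))).
{ intros x; unfold mirror; rewrite Ropp_involutive; reflexivity. }
apply slope_right_comp; auto.
Qed.

Lemma slope_left_inv f g p m : inverses f g -> 0 < m ->
  slope_left f p m -> slope_left g p (/ m).
Proof. intros I; apply slope_right_inv; apply inverses_mirror; auto. Qed.

(** Iterating [g] pushes any point of [[p, p + d]] into the interval where [k] and [l] are known to
    agree; commutation and injectivity of [g] pull the equality back. The radius [d] depends on [g]
    alone, which later makes it uniform over all [x_n]. *)
Lemma contracting_centralizer_germ g gi p m :
  inverses g gi -> 0 < m < 1 -> slope_right g p m ->
  exists d, 0 < d /\ forall k l,
    (forall x, g (k x) = k (g x)) -> (forall x, g (l x) = l (g x)) ->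
    (exists e, 0 < e /\ forall x, p <= x <= p + e -> k x = l x) ->
    forall x, p <= x <= p + d -> k x = l x.
Proof.
intros I hm [d [d0 Hd]]; exists d; split; auto.
intros k l Ck Cl [e [e0 He]].
(* Here [n] bounds the number of applications of [g] that bring [x] within [e] of [p]. *)
assert (K : forall n x, p <= x <= p + d -> m ^ n * (x - p) <= e -> k x = l x).
{ induction n as [| n IH]; simpl; intros x hx h.
  - apply He; lra.
  - apply (inverses_inj g gi); auto.
    rewrite Ck, Cl; apply IH; rewrite Hd by auto.
    + assert (0 <= m * (x - p)) by (apply Rmult_le_pos; lra).
      assert (m * (x - p) <= 1 * (x - p)) by (apply Rmult_le_compat_r; lra).
      lra.
    + replace (p + m * (x - p) - p) with (m * (x - p)) by ring.
      lra. }
intros x hx.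
assert (hm' : Rabs m < 1) by (rewrite Rabs_right; lra).
destruct (pow_lt_1_zero m hm' (e / d)) as [N HN].
{ apply Rdiv_lt_0_compat; auto. }
apply (K N); auto.
specialize (HN N (le_n N)).
assert (0 < m ^ N) by (apply pow_lt; lra).
rewrite Rabs_right in HN by lra.
replace e with (e / d * d) by (field; lra).
apply Rmult_le_compat; lra.
Qed.

(** An expanding [g] is replaced by its inverse, which has the same centralizer. *)
Lemma centralizer_germ g gi p m :
  inverses g gi -> 0 < m -> m <> 1 -> slope_right g p m ->
  exists d, 0 < d /\ forall k l,
    (forall x, g (k x) = k (g x)) -> (forall x, g (l x) = l (g x)) ->
    (exists e, 0 < e /\ forall x, p <= x <= p + e -> k x = l x) ->
    forall x, p <= x <= p + d -> k x = l x.
Proof.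
intros I m0 m1 Hg.
destruct (Rlt_or_le m 1) as [h | h].
{ apply (contracting_centralizer_germ g gi p m); auto. }
destruct (contracting_centralizer_germ gi g p (/ m)) as [d [d0 Hd]].
- apply inverses_sym; auto.
- split; [apply Rinv_0_lt_compat; auto |].
  rewrite <- Rinv_1; apply Rinv_lt_contravar; lra.
- apply (slope_right_inv g gi); auto.
- assert (C : forall k, (forall x, g (k x) = k (g x)) -> forall x, gi (k x) = k (gi x)).
  { intros k Ck x; apply (inverses_inj g gi); auto.
    rewrite Ck, !(proj2 (I _)); reflexivity. }
  exists d; split; auto.
Qed.

(** * The generators [x_n] *)

(* [xgen a ai b n] is the generator [x_(n+1)] of [F], for [a = x_0] and [b = x_1]. *)
Fixpoint xgen (a ai b : R -> R) (n : nat) : R -> R :=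
  match n with
  | O => b
  | S n => fun x => a (xgen a ai b n (ai x))
  end.

Lemma xgen_mirror a ai b n x :
  xgen (mirror a) (mirror ai) (mirror b) n x = mirror (xgen a ai b n) x.
Proof.
revert x; induction n as [| n IH]; intros x; simpl; auto.
rewrite IH; unfold mirror; rewrite !Ropp_involutive; reflexivity.
Qed.

Lemma xgen_inverses a ai b bi n : inverses a ai -> inverses b bi ->
  inverses (xgen a ai b n) (xgen a ai bi n).
Proof.
intros Ia Ib; induction n as [| n IH]; auto.
intros x; simpl; rewrite !(proj1 (Ia _)), (proj1 (IH _)), (proj2 (IH _)).
split; apply Ia.
Qed.

Lemma slope_right_xgen a ai b p m n k : inverses a ai -> 0 < m -> 0 < n ->
  slope_right a p m -> slope_right b p n -> slope_right (xgen a ai b k) p n.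
Proof.
intros I m0 n0 Ha Hb; induction k as [| k IH]; auto.
replace n with (/ m * n * m) by (field; lra).
assert (0 < / m) by (apply Rinv_0_lt_compat; auto).
apply (slope_right_comp (fun x => xgen a ai b k (ai x)) a); auto.
{ apply Rmult_lt_0_compat; auto. }
apply (slope_right_comp ai); auto.
apply (slope_right_inv a ai); auto.
Qed.

(* Given the invertibility of [a] and [b], the last two conditions say that
   [x_0 x_1^-1] commutes with [x_2] and [x_3]. *)
Definition thompson_pair (a ai b bi : R -> R) : Prop :=
  inverses a ai /\ inverses b bi /\ strict_increasing a /\ strict_increasing b /\
  (forall x, xgen a ai b 2 (b x) = b (xgen a ai b 1 x)) /\
  (forall x, xgen a ai b 3 (b x) = b (xgen a ai b 2 x)).

Lemma thompson_pair_mirror a ai b bi : thompson_pair a ai b bi ->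
  thompson_pair (mirror a) (mirror ai) (mirror b) (mirror bi).
Proof.
intros (Ia & Ib & Ma & Mb & R1 & R2).
refine (conj (inverses_mirror _ _ Ia) (conj (inverses_mirror _ _ Ib)
  (conj (increasing_mirror _ Ma) (conj (increasing_mirror _ Mb) (conj _ _)))));
  intros x; rewrite !xgen_mirror; unfold mirror; rewrite !Ropp_involutive; f_equal; auto.
Qed.

(** The two relations are the cases [n = 0] and [n = 1]. For the step, conjugating the induction
    hypotheses by [a] raises all indices: [C1] writes [x_(n+4)] as the conjugate of [x_(n+3)] by
    [x_2], and [C2] does the same for [x_(n+5)], [x_(n+4)] and [x_3]. Conjugation by [b] takes [x_2]
    to [x_3] and [x_(n+3)] to [x_(n+4)], hence [x_(n+4)] to [x_(n+5)]. *)
Lemma xgen_conj_b a ai b bi : thompson_pair a ai b bi ->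
  forall n x, xgen a ai b (S (S n)) (b x) = b (xgen a ai b (S n) x).
Proof.
intros (Ia & Ib & _ & _ & R1 & R2).
assert (K : forall n,
  (forall x, xgen a ai b (S (S n)) (b x) = b (xgen a ai b (S n) x)) /\
  (forall x, xgen a ai b (S (S (S n))) (b x) = b (xgen a ai b (S (S n)) x))).
2: { intros n; apply K. }
induction n as [| n [IH1 IH2]]; split; auto.
assert (C : forall k l x, xgen a ai b (S k) (xgen a ai b (S l) x) =
              a (xgen a ai b k (xgen a ai b l (ai x)))).
{ intros k l x; simpl; rewrite (proj1 (Ia _)); reflexivity. }
assert (C1 : forall x, xgen a ai b (S (S (S n))) (xgen a ai b 1 x) =
               xgen a ai b 1 (xgen a ai b (S (S n)) x)).
{ intros x; rewrite (C (S (S n)) 0%nat), (C 0%nat (S n)); f_equal; apply IH1. }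
assert (C2 : forall x, xgen a ai b (S (S (S (S n)))) (xgen a ai b 2 x) =
               xgen a ai b 2 (xgen a ai b (S (S (S n))) x)).
{ intros x; rewrite (C (S (S (S n))) 1%nat), (C 1%nat (S (S n))); f_equal; apply C1. }
intros x.
rewrite <- (proj2 (xgen_inverses a ai b bi 1 Ia Ib x)).
set (v := xgen a ai bi 1 x).
rewrite C1, <- !R1, C2, IH2; reflexivity.
Qed.

Lemma xgen_conj_a a ai b n x : inverses a ai ->
  xgen a ai b (S n) (a x) = a (xgen a ai b n x).
Proof. intros Ia; simpl; rewrite (proj1 (Ia _)); reflexivity. Qed.

Lemma xgen_agree_near_end a ai b bi p m n :
  thompson_pair a ai b bi -> 0 < m -> 0 < n -> m <> n ->
  slope_right a p m -> slope_right b p n ->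
  exists d, 0 < d /\ forall k, (1 <= k)%nat -> forall x, p <= x <= p + d ->
    xgen a ai b k x = xgen a ai b (S k) x.
Proof.
intros T m0 n0 mn Ha Hb.
pose proof (xgen_conj_b _ _ _ _ T) as Cb.
destruct T as (Ia & Ib & _).
assert (Iy : inverses (fun x => bi (a x)) (fun x => ai (b x))).
{ intros x; rewrite (proj2 (Ib _)), (proj1 (Ia _)), (proj2 (Ia _)), (proj1 (Ib _)); auto. }
assert (n0' : 0 < / n) by (apply Rinv_0_lt_compat; auto).
destruct (centralizer_germ (fun x => bi (a x)) (fun x => ai (b x)) p (m * / n))
  as [d [d0 Hd]]; auto.
- apply Rmult_lt_0_compat; auto.
- intros E; apply mn; replace m with (m * / n * n) by (field; lra); rewrite E; ring.
- apply slope_right_comp; auto; apply (slope_right_inv b bi); auto.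
(* Conjugation by [a] and by [b] have the same effect on these generators, so the quotient of [a] by
   [b] centralizes them. *)
- assert (Cy : forall k x, bi (a (xgen a ai b (S k) x)) = xgen a ai b (S k) (bi (a x))).
  { intros k x; apply (inverses_inj b bi); auto.
    rewrite <- Cb, !(proj2 (Ib _)), xgen_conj_a; auto. }
  exists d; split; auto.
  intros [| k] hk; [lia |].
  apply Hd; auto.
  destruct (slope_right_xgen a ai b p m n (S k)) as [e [e0 He]]; auto.
  destruct (slope_right_xgen a ai b p m n (S (S k))) as [f [f0 Hf]]; auto.
  exists (Rmin e f); split; [apply Rmin_pos; auto |].
  intros x hx; pose proof (Rmin_l e f); pose proof (Rmin_r e f).
  rewrite He, Hf; lra.
Qed.

(** * Spreading the agreement of the generators over an orbital *)

(** An increasing bijection that preserves [G] carries its least upper bound to a least upper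
    bound. *)
Lemma invariant_lub f g (G : R -> Prop) s : inverses f g -> strict_increasing f ->
  (forall z, G z <-> G (f z)) -> is_lub G s -> f s = s.
Proof.
intros I M Inv [ub lub].
pose proof (increasing_inv f g I M) as M'.
apply Rle_antisym.
- rewrite <- (proj2 (I s)) at 2.
  apply increasing_le; auto.
  apply lub; intros z Gz.
  rewrite <- (proj1 (I z)); apply increasing_le; auto.
  apply ub; apply Inv in Gz; auto.
- apply lub; intros z Gz.
  rewrite <- (proj2 (I z)) in Gz |- *.
  apply increasing_le; auto.
  apply ub; apply Inv; auto.
Qed.

Lemma xgen_agree_from_end a ai b bi p q m n :
  thompson_pair a ai b bi -> p < q -> a p = p -> b p = p -> a q = q -> b q = q ->
  (forall z, p < z < q -> a z <> z \/ b z <> z) ->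
  0 < m -> 0 < n -> m <> n -> slope_right a p m -> slope_right b p n ->
  forall z, z < q -> exists N, forall k, (N <= k)%nat -> forall x, p <= x <= z ->
    xgen a ai b k x = xgen a ai b (S k) x.
Proof.
intros T pq ap bp aq bq nofix m0 n0 mn Ha Hb.
pose proof (xgen_agree_near_end _ _ _ _ _ _ _ T m0 n0 mn Ha Hb) as [d [d0 Hd]].
pose proof (xgen_conj_b _ _ _ _ T) as Cb.
destruct T as (Ia & Ib & Ma & Mb & _).
(* The bound [1 <= N] is there because [b] shifts only the [xgen] indices from 1 on. Moving [z] by a
   generator can cost one index, so [N] depends on [z]. *)
set (G z := p <= z <= q /\ exists N, (1 <= N)%nat /\ forall k, (N <= k)%nat ->
  forall x, p <= x <= z -> xgen a ai b k x = xgen a ai b (S k) x).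
assert (Inv : forall f g, inverses f g -> strict_increasing f -> f p = p -> f q = q ->
  (forall k x, xgen a ai b (S (S k)) (f x) = f (xgen a ai b (S k) x)) ->
  forall z, G z <-> G (f z)).
{ intros f g I M fp fq Cf z.
  pose proof (increasing_inv f g I M) as M'.
  assert (gp : g p = p) by (rewrite <- fp at 1; apply I).
  assert (gq : g q = q) by (rewrite <- fq at 1; apply I).
  split; intros [[h1 h2] (N & N1 & HN)]; split.
  - rewrite <- fp, <- fq; split; apply increasing_le; auto.
  - exists (S N); split; [lia |].
    intros [| [| k]] hk x hx; try lia.
    rewrite <- (proj2 (I x)), !Cf; f_equal.
    apply HN; [lia |].
    rewrite <- gp, <- (proj1 (I z)); split; (apply increasing_le; [auto | lra]).
  - rewrite <- gp, <- gq, <- (proj1 (I z)); split; apply increasing_le; auto.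
  - exists N; split; auto.
    intros [| k] hk x hx; try lia.
    apply (inverses_inj f g); auto.
    rewrite <- !Cf; apply HN; [lia |].
    rewrite <- fp; split; (apply increasing_le; [auto | lra]). }
assert (Gd : G (Rmin (p + d) q)).
{ pose proof (Rmin_l (p + d) q); pose proof (Rmin_r (p + d) q).
  split; [split; [apply Rmin_glb; lra | lra] |].
  exists 1%nat; split; auto.
  intros k hk x hx; apply Hd; auto; lra. }
destruct (completeness G) as [s Hs].
{ exists q; intros z Gz; apply Gz. }
{ exists (Rmin (p + d) q); auto. }
assert (as_ : a s = s).
{ apply (invariant_lub a ai G); auto.
  apply (Inv a ai); auto; intros; apply xgen_conj_a; auto. }
assert (bs : b s = s).
{ apply (invariant_lub b bi G); auto; apply (Inv b bi); auto. }
destruct Hs as [ub lub].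
assert (ps : p < s).
{ apply Rlt_le_trans with (Rmin (p + d) q); [apply Rmin_glb_lt; lra | auto]. }
assert (sq : s <= q) by (apply lub; intros z Gz; apply Gz).
assert (s = q) as ->.
{ destruct sq as [sq |]; auto; destruct (nofix s); tauto. }
intros z zq.
apply NNPP; intros no.
assert (q <= z); [| lra].
apply lub; intros w [hw (N & N1 & HN)].
destruct (Rle_or_lt w z) as [| zw]; auto.
exfalso; apply no; exists N; intros k hk x hx; apply HN; auto; lra.
Qed.

Lemma commute_of_slopes a ai b bi p q m n m' n' :
  thompson_pair a ai b bi -> p < q -> a p = p -> b p = p -> a q = q -> b q = q ->
  (forall z, p < z < q -> a z <> z \/ b z <> z) ->
  0 < m -> 0 < n -> m <> n -> slope_right a p m -> slope_right b p n ->
  0 < m' -> 0 < n' -> m' <> n' -> slope_left a q m' -> slope_left b q n' ->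
  forall x, p <= x <= q -> b (a x) = a (b x).
Proof.
intros T pq ap bp aq bq nofix m0 n0 mn Ha Hb m0' n0' mn' Ha' Hb'.
set (c := (p + q) / 2).
destruct (xgen_agree_from_end a ai b bi p q m n) with (z := c) as [N HN]; auto.
{ unfold c; lra. }
destruct (xgen_agree_from_end (mirror a) (mirror ai) (mirror b) (mirror bi)
  (- q) (- p) m' n') with (z := - c) as [N' HN'];
  try (unfold mirror; rewrite Ropp_involutive; f_equal); auto.
{ apply thompson_pair_mirror; auto. }
{ intros z hz; unfold mirror.
  destruct (nofix (- z)) as [h | h]; [lra | left | right]; intros E; apply h; lra. }
{ unfold c; lra. }
assert (Ia : inverses a ai) by apply T.
assert (Ma : strict_increasing a) by apply T.
(* The two halves meeting at [c] give agreement on [[p, q]] for indices from [N + N'] on. Each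
   further unit of [j] lowers the index by one, by conjugating back with [a], down to [xgen] index
   0, where the equality reads [b = b^a]. *)
assert (K : forall j k, (N + N' <= k + j)%nat -> forall x, p <= x <= q ->
  xgen a ai b k x = xgen a ai b (S k) x).
{ induction j as [| j IH]; intros k hk x hx.
  - destruct (Rle_or_lt x c).
    + apply HN; [lia | lra].
    + assert (E := HN' k ltac:(lia) (- x) ltac:(lra)).
      rewrite !xgen_mirror in E; unfold mirror in E.
      rewrite !Ropp_involutive in E; lra.
  - apply (inverses_inj a ai); auto.
    rewrite <- !xgen_conj_a by auto.
    apply IH; [lia |].
    rewrite <- ap, <- aq; split; (apply increasing_le; [auto | lra]). }
intros x hx.
rewrite (K (N + N')%nat 0%nat); [| lia |].
- apply xgen_conj_a; auto.
- rewrite <- ap, <- aq; split; (apply increasing_le; [auto | lra]).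
Qed.

(** After cancellation, each relation for the new pair is the corresponding old one composed on both
    sides with powers of [a] and [ai]. Slopes [m], [n] of [a], [b] at a common fixed point become
    [1/m] and [n/m], which differ as soon as [n <> 1]. *)
Lemma thompson_pair_swap_ends a ai b bi : thompson_pair a ai b bi ->
  thompson_pair ai a (fun x => ai (ai (b (a x)))) (fun x => ai (bi (a (a x)))).
Proof.
intros (Ia & Ib & Ma & Mb & R1 & R2).
pose proof (increasing_inv a ai Ia Ma) as Ma'.
simpl in R1, R2.
assert (aK : forall x, a (ai x) = x) by (intros; apply Ia).
assert (aiK : forall x, ai (a x) = x) by (intros; apply Ia).
assert (bK : forall x, b (bi x) = x) by (intros; apply Ib).
assert (biK : forall x, bi (b x) = x) by (intros; apply Ib).
refine (conj (inverses_sym _ _ Ia) (conj _ (conj Ma' (conj _ (conj _ _))))).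
- intros x; split; rewrite !aK, ?biK, ?bK, ?aiK; reflexivity.
- intros x y h; auto.
- intros x; simpl; specialize (R1 (a (a x))).
  rewrite !aiK in R1; rewrite !aK, <- R1, !aiK; reflexivity.
- intros x; simpl; specialize (R2 (a (a (a x)))).
  rewrite !aiK in R2; rewrite !aK, <- R2, !aiK; reflexivity.
Qed.

(** * Elements of [PL_0(I)] and words *)

Lemma increasing_PL0 f : is_PL0 f -> strict_increasing f.
Proof.
intros (out & f0 & f1 & inc & _) x y h.
assert (pos : forall z, 0 <= z <= 1 -> 0 <= f z <= 1).
{ intros z [[h1 | <-] [h2 | ->]]; try lra.
  assert (f 0 < f z) by (apply inc; lra).
  assert (f z < f 1) by (apply inc; lra); lra. }
destruct (Rlt_or_le x 0), (Rlt_or_le 1 x), (Rlt_or_le y 0), (Rlt_or_le 1 y);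
  try (rewrite (out x) by lra); try (rewrite (out y) by lra);
  try (pose proof (pos x ltac:(lra))); try (pose proof (pos y ltac:(lra))); try lra.
apply inc; lra.
Qed.

Lemma slope_right_PL0 f p : is_PL0 f -> 0 <= p < 1 -> f p = p ->
  exists m, 0 < m /\ slope_right f p m.
Proof.
intros Hf hp fp.
pose proof (increasing_PL0 f Hf) as M.
destruct Hf as (_ & _ & _ & _ & n & t & t0 & tn & _ & lin).
(* The piece is taken closed on the left and open on the right, so that it extends beyond [p] on the
   right. *)
assert (K : forall k, p < t k -> exists i, (i < k)%nat /\ t i <= p < t (S i)).
{ induction k as [| k IH]; intros h; [lra |].
  destruct (Rlt_or_le p (t k)) as [h' | h'].
  - destruct (IH h') as [i [hi ti]]; exists i; split; auto; lia.
  - exists k; split; auto; lia. }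
destruct (K n) as [i [hi ti]]; [lra |].
destruct (lin i hi) as [m [c E]].
assert (E' : forall x, p <= x <= p + (t (S i) - p) -> f x = p + m * (x - p)).
{ intros x hx; rewrite E by lra.
  assert (f p = m * p + c) by (apply E; lra).
  assert (c = p - m * p) as -> by lra; ring. }
exists m; split; [| exists (t (S i) - p); split; auto; lra].
assert (f p < f (t (S i))) by (apply M; lra).
rewrite (E' (t (S i))) in * by lra.
apply Rmult_lt_reg_r with (t (S i) - p); lra.
Qed.

Lemma slope_left_PL0 f q : is_PL0 f -> 0 < q <= 1 -> f q = q ->
  exists m, 0 < m /\ slope_left f q m.
Proof.
intros Hf hq fq.
pose proof (increasing_PL0 f Hf) as M.
destruct Hf as (_ & _ & _ & _ & n & t & t0 & tn & _ & lin).
assert (K : forall k, q <= t k -> exists i, (i < k)%nat /\ t i < q <= t (S i)).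
{ induction k as [| k IH]; intros h; [lra |].
  destruct (Rle_or_lt q (t k)) as [h' | h'].
  - destruct (IH h') as [i [hi ti]]; exists i; split; auto; lia.
  - exists k; split; auto; lia. }
destruct (K n) as [i [hi ti]]; [lra |].
destruct (lin i hi) as [m [c E]].
assert (E' : forall x, t i <= x <= q -> f x = q + m * (x - q)).
{ intros x hx; rewrite E by lra.
  assert (f q = m * q + c) by (apply E; lra).
  assert (c = q - m * q) as -> by lra; ring. }
exists m; split.
- assert (f (t i) < f q) by (apply M; lra).
  rewrite (E' (t i)) in * by lra.
  apply Rmult_lt_reg_r with (q - t i); lra.
- exists (q - t i); split; [lra |].
  intros x hx; unfold mirror; rewrite E' by lra; ring.
Qed.

Lemma word_eval_app a ai b bi u v x :
  word_eval a ai b bi (u ++ v) x = word_eval a ai b bi v (word_eval a ai b bi u x).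
Proof. revert x; induction u as [| l u IH]; intros x; simpl; auto. Qed.

Lemma word_eval_fixed a ai b bi x : inverses a ai -> inverses b bi ->
  a x = x -> b x = x -> forall w, word_eval a ai b bi w x = x.
Proof.
intros Ia Ib ax bx.
assert (aix : ai x = x) by (rewrite <- ax at 1; apply Ia).
assert (bix : bi x = x) by (rewrite <- bx at 1; apply Ib).
induction w as [| [[] []] w IH]; simpl; rewrite ?ax, ?aix, ?bx, ?bix; auto.
Qed.

Lemma word_eval_Fequiv a ai b bi : inverses a ai -> inverses b bi ->
  (forall r, In r F_relators -> forall x, word_eval a ai b bi r x = x) ->
  forall u v, Fequiv u v -> forall x, word_eval a ai b bi u x = word_eval a ai b bi v x.
Proof.
intros Ia Ib rel u v E.
induction E as [| ? ? _ IH | ? ? ? _ IH1 _ IH2 | u v l | u v r hr]; intros x; auto.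
- rewrite IH1; auto.
- rewrite !word_eval_app; simpl; f_equal.
  destruct l as [[] []]; simpl; first [apply Ia | apply Ib].
- rewrite !word_eval_app, (rel r hr); auto.
Qed.

(** * [F] is not abelian *)

(* The standard action of [F] on the line, in which [x0] is a translation. *)
Definition shift (x : R) : R := x + 1.
Definition unshift (x : R) : R := x - 1.

(** The image of [x1]: the identity up to 0, and equal to [shift] from 1 on. Hence [x0 x1^-1] is the
    identity on [x >= 1], while the conjugates of [x1] by [x0] and [x0^2] are the identity on
    [x <= 1]; disjoint supports give the relators. *)
Definition half_shift (x : R) : R :=
  if Rle_dec x 0 then x else if Rle_dec x 1 then 2 * x else x + 1.

Definition half_unshift (x : R) : R :=
  if Rle_dec x 0 then x else if Rle_dec x 2 then x / 2 else x - 1.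

Lemma F_not_abelian : ~ Fequiv [x0; x1] [x1; x0].
Proof.
intros E.
apply (word_eval_Fequiv shift unshift half_shift half_unshift) with (x := - (1 / 2)) in E.
- simpl in E; unfold shift, half_shift in E.
  repeat destruct Rle_dec in E; lra.
- intros x; unfold shift, unshift; lra.
- intros x; unfold half_shift, half_unshift; split; repeat destruct Rle_dec; lra.
(* Innermost tests are split first, so that each test compares linear expressions. *)
- intros r [<- | [<- | []]] x; simpl; unfold shift, unshift, half_shift, half_unshift;
  repeat match goal with |- context [Rle_dec ?u ?v] =>
    lazymatch u with
    | context [Rle_dec _ _] => fail
    | _ => destruct (Rle_dec u v); try (exfalso; lra)
    end
  end; lra.
Qed.

(** * From the relators to conjugation identities *)

Lemma thompson_pair_of_relators a ai b bi :
  inverses a ai -> inverses b bi -> strict_increasing a -> strict_increasing b ->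
  (forall r, In r F_relators -> forall x, word_eval a ai b bi r x = x) ->
  thompson_pair a ai b bi.
Proof.
intros Ia Ib Ma Mb rel.
assert (aK : forall x, a (ai x) = x) by (intros; apply Ia).
assert (aiK : forall x, ai (a x) = x) by (intros; apply Ia).
assert (bK : forall x, b (bi x) = x) by (intros; apply Ib).
assert (biK : forall x, bi (b x) = x) by (intros; apply Ib).
refine (conj Ia (conj Ib (conj Ma (conj Mb (conj _ _))))); intros x; simpl.
(* The relator is evaluated at the point which its letters up to the second [X1] send to [x]. *)
- assert (E := rel rel1 (or_introl eq_refl) (bi (a (a (b (ai (ai (b x)))))))).
  simpl in E; rewrite bK, !aiK, biK, !aK, biK in E.
  apply (f_equal b) in E; rewrite bK in E; auto.
- assert (E := rel rel2 (or_intror (or_introl eq_refl))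
    (bi (a (a (a (b (ai (ai (ai (b x)))))))))).
  simpl in E; rewrite bK, !aiK, biK, !aK, biK in E.
  apply (f_equal b) in E; rewrite bK in E; auto.
Qed.

(** * Orbitals *)

(** The ends are the common fixed points nearest to [x] on either side. The sets of candidates
    contain 0 and 1 respectively and are fixed pointwise by [H], hence invariant, so [invariant_lub]
    makes their extremal points common fixed points too. *)
Lemma orbital_containing H x : is_PL0_subgroup H -> in_supp H x ->
  exists p q, 0 <= p < x /\ x < q <= 1 /\ is_orbital H p q.
Proof.
intros (PL & _ & _ & inv) [hx [h0 [Hh0 h0x]]].
assert (fix0 : forall z, 0 <= z <= 1 -> ~ in_supp H z -> forall h, H h -> h z = z).
{ intros z hz no h Hh; apply NNPP; intros E; apply no; split; eauto. }
assert (fix_end : forall z h, z = 0 \/ z = 1 -> H h -> h z = z).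
{ intros z h [-> | ->] Hh; apply (PL h Hh). }
destruct (completeness (fun z => 0 <= z <= x /\ forall h, H h -> h z = z)) as [p Hp].
{ exists x; intros z hz; apply hz. }
{ exists 0; split; [lra | auto]. }
(* The infimum on the right is taken as a supremum of negatives; the right end is [- q]. *)
destruct (completeness (fun z => x <= - z <= 1 /\ forall h, H h -> h (- z) = - z))
  as [q Hq].
{ exists (- x); intros z hz; lra. }
{ exists (- (1)); rewrite Ropp_involutive; split; [lra | auto]. }
assert (pfix : forall h, H h -> h p = p).
{ intros h Hh; pose proof (increasing_PL0 h (PL h Hh)) as M.
  destruct (inv h Hh) as [g [_ I]].
  eapply invariant_lub; eauto.
  intros z; split; intros [hz Fz].
  - rewrite (Fz h Hh); auto.
  - assert (E : h z = z) by (apply (inverses_inj h g); auto).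
    rewrite E in hz, Fz; auto. }
assert (qfix : forall h, H h -> h (- q) = - q).
{ intros h Hh; pose proof (increasing_PL0 h (PL h Hh)) as M.
  destruct (inv h Hh) as [g [_ I]].
  assert (E : mirror h q = q); [| unfold mirror in E; lra].
  eapply invariant_lub; [apply inverses_mirror; exact I | | | exact Hq].
  { apply increasing_mirror; auto. }
  intros z; unfold mirror; rewrite Ropp_involutive; split; intros [hz Fz].
  - rewrite (Fz h Hh); auto.
  - assert (E : h (- z) = - z) by (apply (inverses_inj h g); auto).
    rewrite E in hz, Fz; auto. }
destruct Hp as [ubp lubp], Hq as [ubq lubq].
assert (0 <= p) by (apply ubp; split; [lra | auto]).
assert (p <= x) by (apply lubp; intros z hz; apply hz).
assert (q <= - x) by (apply lubq; intros z hz; lra).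
assert (- (1) <= q) by (apply ubq; rewrite Ropp_involutive; split; [lra | auto]).
assert (p <> x) by (intros ->; auto).
assert (- q <> x) by (intros E; apply h0x; rewrite <- E; auto).
exists p, (- q).
split; [lra |]; split; [lra |]; split; [lra |]; split; [| split].
- intros z hz; apply NNPP; intros no.
  destruct (Rle_or_lt z x).
  + assert (z <= p); [| lra].
    apply ubp; split; [lra |]; apply fix0; [lra | auto].
  + assert (- z <= q); [| lra].
    apply ubq; rewrite Ropp_involutive; split; [lra |]; apply fix0; [lra | auto].
- intros [_ [h [Hh E]]]; auto.
- intros [_ [h [Hh E]]]; auto.
Qed.

(** * Slopes at the two ends of an orbital *)

Lemma positive_below_three u v w : 0 < u -> 0 < v -> 0 < w ->
  exists t, 0 < t /\ t <= u /\ t <= v /\ t <= w.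
Proof.
intros; exists (Rmin (Rmin u v) w).
pose proof (Rmin_l (Rmin u v) w); pose proof (Rmin_r (Rmin u v) w).
pose proof (Rmin_l u v); pose proof (Rmin_r u v).
split; [repeat apply Rmin_pos; auto | lra].
Qed.

Lemma moves_near_left_only_of_slopes h p q m n : p < q ->
  slope_right h p m -> slope_left h q n -> m <> 1 -> n = 1 ->
  moves_near_left_only h p q.
Proof.
intros pq [d [d0 Hd]] [e [e0 He]] m1 ->; split.
- intros eps eps0.
  destruct (positive_below_three d eps (q - p)) as [t ht]; try lra.
  exists (p + t / 2); repeat split; try lra.
  rewrite Hd by lra; intros E; apply m1.
  apply Rmult_eq_reg_r with (t / 2); lra.
- exists e; split; auto; intros x hx _.
  assert (E := He (- x) ltac:(lra)); unfold mirror in E.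
  rewrite Ropp_involutive in E; lra.
Qed.

Lemma moves_near_right_only_of_slopes h p q m n : p < q ->
  slope_right h p m -> slope_left h q n -> m = 1 -> n <> 1 ->
  moves_near_right_only h p q.
Proof.
intros pq [d [d0 Hd]] [e [e0 He]] -> n1; split.
- intros eps eps0.
  destruct (positive_below_three e eps (q - p)) as [t ht]; try lra.
  exists (q - t / 2); repeat split; try lra.
  intros E; apply n1.
  assert (E' := He (- q + t / 2) ltac:(lra)); unfold mirror in E'.
  replace (- (- q + t / 2)) with (q - t / 2) in E' by ring.
  apply Rmult_eq_reg_r with (t / 2); lra.
- exists d; split; auto; intros x hx _; rewrite Hd; lra.
Qed.

Theorem theorem3p2 (H : (R -> R) -> Prop) :
  is_PL0_subgroup H -> iso_to_F H ->
  exists a c h, is_orbital H a c /\ H h /\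
    (moves_near_left_only h a c \/ moves_near_right_only h a c).
Proof.
intros HH (a & ai & b & bi & Ha & Hai & Hb & Hbi & Ia & Ib & onto & faithful).
pose proof (proj1 HH) as PL.
pose proof (proj1 (proj2 (proj2 HH))) as closed.
assert (Ma := increasing_PL0 a (PL a Ha)).
assert (Mb := increasing_PL0 b (PL b Hb)).
assert (T : thompson_pair a ai b bi).
{ apply thompson_pair_of_relators; auto.
  intros r hr; apply (proj2 (faithful r [])).
  rewrite <- (app_nil_r r); apply (Fe_rel [] [] r hr). }
assert (exists x, b (a x) <> a (b x)) as [x hx].
{ apply NNPP; intros no; apply F_not_abelian, faithful; intros x; simpl.
  apply NNPP; intros E; apply no; exists x; auto. }
assert (Sx : in_supp H x).
{ apply NNPP; intros no; apply hx.
  assert (F : forall h, H h -> h x = x); [| rewrite !F; auto].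
  intros h Hh; apply NNPP; intros E.
  destruct (Rlt_or_le x 0); [apply E, (PL h Hh); auto |].
  destruct (Rlt_or_le 1 x); [apply E, (PL h Hh); auto |].
  apply no; split; [lra | eauto]. }
destruct (orbital_containing H x HH Sx) as (p & q & hp & hq & O).
apply NNPP; intros no.
assert (pfix : forall h, H h -> h p = p).
{ intros h Hh; apply NNPP; intros E.
  apply (proj1 (proj2 (proj2 O))); split; [lra | eauto]. }
assert (qfix : forall h, H h -> h q = q).
{ intros h Hh; apply NNPP; intros E.
  apply (proj2 (proj2 (proj2 O))); split; [lra | eauto]. }
assert (balanced : forall h m n, H h -> slope_right h p m -> slope_left h q n ->
  (m = 1 <-> n = 1)).
{ intros h m n Hh Hm Hn.
  destruct (Req_dec m 1) as [m1 | m1], (Req_dec n 1) as [n1 | n1]; try tauto;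
    exfalso; apply no; exists p, q, h; split; auto; split; auto.
  - right; eapply moves_near_right_only_of_slopes; eauto; lra.
  - left; eapply moves_near_left_only_of_slopes; eauto; lra. }
assert (nofix : forall z, p < z < q -> a z <> z \/ b z <> z).
{ intros z hz.
  destruct (Req_dec (a z) z), (Req_dec (b z) z); auto.
  destruct (proj1 (proj2 O) z hz) as [_ [h [Hh E]]].
  destruct (onto h Hh) as [w Ew].
  exfalso; apply E; rewrite Ew; apply word_eval_fixed; auto. }
destruct (slope_right_PL0 a p) as [m [m0 Am]]; auto; [lra |].
destruct (slope_right_PL0 b p) as [n [n0 Bn]]; auto; [lra |].
destruct (slope_left_PL0 a q) as [m' [m0' Am']]; auto; [lra |].
destruct (slope_left_PL0 b q) as [n' [n0' Bn']]; auto; [lra |].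
assert (inv_pos : forall r, 0 < r -> 0 < / r) by (intros; apply Rinv_0_lt_compat; auto).
assert (quot1 : forall r s, 0 < s -> (r * / s = 1 <-> r = s)).
{ intros r s s0; split; intros E; [| rewrite E; field; lra].
  replace r with (r * / s * s) by (field; lra); rewrite E; ring. }
(* Balance is applied to [x0 x1^-1], whose slopes at the ends are [m / n] and [m' / n']. *)
assert (hY : m = n <-> m' = n').
{ rewrite <- (quot1 m n), <- (quot1 m' n') by auto; apply (balanced (fun x => bi (a x))); auto.
  - apply slope_right_comp; auto; apply (slope_right_inv b); auto.
  - apply slope_left_comp; auto; apply (slope_left_inv b); auto. }
assert (hB : n = 1 <-> n' = 1) by (apply (balanced b); auto).
apply hx.
destruct (Req_dec m n) as [mn | mn].
2: { apply (commute_of_slopes a ai b bi p q m n m' n'); auto; try lra; tauto. }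
(* If both slopes at [p] were 1, then [a] and [b] would fix every point just to the right of [p]. *)
assert (n1 : n <> 1).
{ intros n1.
  destruct Am as [d [d0 Hd]], Bn as [e [e0 He]].
  destruct (positive_below_three d e ((q - p) / 2)) as [t ht]; try lra.
  destruct (nofix (p + t)) as [E | E]; [lra | |]; apply E.
  - rewrite Hd, mn, n1 by lra; ring.
  - rewrite He, n1 by lra; ring. }
assert (aK : forall z, a (ai z) = z) by (intros; apply Ia).
assert (aiK : forall z, ai (a z) = z) by (intros; apply Ia).
assert (E : forall z, p <= z <= q -> ai (ai (b (a (ai z)))) = ai (ai (ai (b (a z))))).
{ apply (commute_of_slopes ai a (fun z => ai (ai (b (a z)))) (fun z => ai (bi (a (a z))))
    p q (/ m) (m * n * / m * / m) (/ m') (m' * n' * / m' * / m')); auto.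
  - apply thompson_pair_swap_ends; auto.
  - lra.
  - rewrite !pfix; auto.
  - rewrite !qfix; auto.
  - intros z hz.
    destruct (Req_dec (ai z) z) as [E1 | E1]; auto; right; intros E2.
    assert (az : a z = z) by (rewrite <- E1 at 1; auto).
    apply (f_equal a) in E2; rewrite aK, az in E2.
    apply (f_equal a) in E2; rewrite aK, az in E2.
    destruct (nofix z); auto.
  - repeat apply Rmult_lt_0_compat; auto.
  - intros E; apply n1; apply (Rmult_eq_reg_r (/ m));
      [| apply Rgt_not_eq, inv_pos; auto].
    replace (n * / m) with (m * n * / m * / m) by (field; lra); lra.
  - apply (slope_right_inv a); auto.
  - repeat apply slope_right_comp; auto; try (apply (slope_right_inv a); auto);
      repeat apply Rmult_lt_0_compat; auto.
  - repeat apply Rmult_lt_0_compat; auto.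
  - intros E; apply n1, hB; apply (Rmult_eq_reg_r (/ m'));
      [| apply Rgt_not_eq, inv_pos; auto].
    replace (n' * / m') with (m' * n' * / m' * / m') by (field; lra); lra.
  - apply (slope_left_inv a); auto.
  - repeat apply slope_left_comp; auto; try (apply (slope_left_inv a); auto);
      repeat apply Rmult_lt_0_compat; auto. }
specialize (E x ltac:(lra)).
(* Three applications of [a] turn commutation of the swapped pair at [x] into that of [a] and
   [b]. *)
do 3 (apply (f_equal a) in E; rewrite !aK in E); auto.
Qed.
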